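(* Let $m\in\mathbb{N}$ and $P=X^{2m}+2X^m+2\in\mathbb{Z}[X]$. Then $$\ell_P(\mathbb{Z})=\{m\bigl(a(n)-1\bigr)+1 : n\in\mathbb{N}\},$$ where $(a(n))_{n\ge0}$ is the sequence defined by $a(0)=0$ and $a(n)=a(n-1)+(-1)^n+2$ for $n\in\mathbb{N}$.
   Context: $\mathbb{N}$ is the set of positive integers. Let $p\in\mathbb{Z}[X]$ be monic with $|p(0)|>1$ and put $D_p:=\{0,\ldots,|p(0)|-1\}$. An integer $z$ is $p$-canonically representable if there exist a positive integer $\ell$ and $u_0,\ldots,u_{\ell-1}\in D_p$ with $z\equiv\sum_{j=0}^{\ell-1}u_jX^j\pmod p$ in $\mathbb{Z}[X]$; the representation is unique if it exists (up to leading zeros). The least such $\ell$ is the length of the $p$-canonical representation of $z$, denoted $\ell_p(z)$ (so $\ell_p(0)=1$). The notation $\ell_P(\mathbb{Z})=\{\ell_P(z): z\in\mathbb{Z}\}$ includes the assertion that every integer is $P$-canonically representable. *)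

(* Defs.v *)
From HB Require Import structures.
From mathcomp Require Import all_boot all_order all_algebra.
Set Implicit Arguments.
Unset Strict Implicit.
Unset Printing Implicit Defensive.
Import Order.TTheory GRing.Theory Num.Theory.
Local Open Scope ring_scope.

(* Congruence modulo the principal ideal of Z[X] generated by p. It is spelled
   out because polydiv's %| on {poly int} is pseudo-divisibility, i.e.
   divisibility up to a nonzero integer factor. *)
Definition eqmodp (p f g : {poly int}) : Prop :=
  exists q : {poly int}, f - g = q * p.

Definition digit (p : {poly int}) (u : int) : bool :=
  (0 <= u) && (u <= `|p.[0]| - 1).

(* Leading zero digits are allowed. *)
Definition canonical_rep (p : {poly int}) (z : int) (l : nat) : Prop :=
  (0 < l)%N /\
  exists u : 'I_l -> int,
    (forall j, digit p (u j)) /\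
    eqmodp p z%:P (\sum_(j < l) (u j)%:P * 'X^j).

Definition canonically_representable (p : {poly int}) (z : int) : Prop :=
  exists l : nat, canonical_rep p z l.

(* l is the length of z; as leading zeros are allowed, the length is the least
   l, and 0 has length 1. *)
Definition is_length (p : {poly int}) (z : int) (l : nat) : Prop :=
  canonical_rep p z l /\
  forall k : nat, canonical_rep p z k -> (l <= k)%N.

Fixpoint a (n : nat) : int :=
  if n is k.+1 then a k + (-1) ^+ n + 2 else 0.

(* Main.v *)
Require Import Defs.
From HB Require Import structures.
From mathcomp Require Import all_boot all_order all_algebra.
From mathcomp Require Import zify ring.
Set Implicit Arguments.
Unset Strict Implicit.
Unset Printing Implicit Defensive.
Import Order.TTheory GRing.Theory Num.Theory.
Local Open Scope ring_scope.

(** Put Y = X^m, so that P = Y^2 + 2Y + 2 and the digits are 0 and 1.  Since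
    Y^4 + 4 = P (Y^2 - 2Y + 2) and Y^3 + Y^2 - 2 = P (Y - 1), modulo P
    one has Y^4 = -4 and Y^3 + Y^2 = 2.  Hence an expansion of z
    in base -4 with digits 0, 1, 2, 3 turns into a P-canonical representation
    on replacing each digit by the block 0, 1, Y^3 + Y^2 or Y^3 + Y^2 + 1 and
    the base by Y^4 ([cons_block_eqmodp]).  Every integer has an expansion in
    base -4 ([digit_expansion]).

    For any p with p(0) <> 0, two digit polynomials congruent modulo p are
    equal ([digit_poly_uniq]), so the length of z can be read off any
    representation of z ([is_lengthE]).  If the expansion of z <> 0 in base -4
    has k digits, the leading block ends at Y^(4(k-1)) or at Y^(4(k-1)+3),
    according to whether the leading digit is 1 or exceeds 1: the length is
    m(a - 1) + 1 with a = 4(k-1) + 1 or a = 4k.  These are the values of the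
    sequence [a] at 2k - 1 and 2k, because a(n+2) = a(n) + 4.  All of them
    occur, as multiplying 1 and 2 by powers of -4 shows ([length_attained]). *)

(** * Digit polynomials and length *)

Definition digit_poly (p w : {poly int}) : Prop := forall i, digit p w`_i.

Lemma eqmodp_sym p f g : eqmodp p f g -> eqmodp p g f.
Proof. by case=> q e; exists (- q); rewrite mulNr -e opprB. Qed.

Lemma eqmodp_trans p f g h : eqmodp p f g -> eqmodp p g h -> eqmodp p f h.
Proof.
case=> q eq_fg [r eq_gh]; exists (q + r).
by rewrite mulrDl -eq_fg -eq_gh addrA subrK.
Qed.

(** If w - w' = q p, the lowest nonzero coefficient of q, multiplied by p(0),
    would be a difference of two digits, which is smaller than p(0) in absolute
    value. *)
Lemma digit_poly_uniq p w w' :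
  digit_poly p w -> digit_poly p w' -> eqmodp p w w' -> w = w'.
Proof.
move=> dw dw' [q eq_q]; suff q0 : q = 0.
  by apply/eqP; rewrite -subr_eq0 eq_q q0 mul0r.
apply/polyP=> i; rewrite coef0; elim/ltn_ind: i => i IHi.
have := congr1 (fun f : {poly int} => f`_i) eq_q.
rewrite coefB coefM big_ord_recr /= subnn big1 ?add0r; last first.
  by move=> j _; rewrite IHi ?mul0r.
have := dw i; have := dw' i; rewrite /digit horner_coef0.
move: (w`_i) (w'`_i) (q`_i) (p`_0) => x y c d /andP[y0 yd] /andP[x0 xd] exy.
have : `|c * d| < `|d| by rewrite -exy; lia.
by rewrite normrM; have [->//|] := eqVneq c 0; nia.
Qed.

Lemma canonical_rep_digit_poly p z l : p.[0] != 0 -> canonical_rep p z l ->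
  exists w, [/\ digit_poly p w, eqmodp p z%:P w & (size w <= l)%N].
Proof.
move=> p0 [l_gt0 [u [du eu]]]; exists (\sum_(j < l) (u j)%:P * 'X^j).
have coefu i : (\sum_(j < l) (u j)%:P * 'X^j)`_i =
    if (insub i : option 'I_l) is Some j then u j else 0.
  rewrite coef_sum; case: insubP => [j _ <-|ge_il].
    rewrite (bigD1 j) //= coefCM coefXn eqxx mulr1 big1 ?addr0 // => k ne_kj.
    by rewrite coefCM coefXn eq_sym (inj_eq val_inj) (negbTE ne_kj) mulr0.
  rewrite big1 // => k _; rewrite coefCM coefXn.
  by case: eqP ge_il => [->|]; rewrite ?ltn_ord ?mulr0.
split=> // [i|].
  by rewrite coefu; case: insub => [j|]; rewrite ?du // /digit; lia.
by apply/leq_sizeP => i le_li; rewrite coefu insubF // ltnNge le_li.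
Qed.

Lemma digit_poly_canonical_rep p z (w : {poly int}) l :
  (0 < l)%N -> (size w <= l)%N -> digit_poly p w ->
  eqmodp p z%:P w -> canonical_rep p z l.
Proof.
move=> l_gt0 le_wl dw ew; split=> //; exists (fun j => w`_j); split=> //.
suff <- : w = \sum_(j < l) (w`_j)%:P * 'X^j by [].
rewrite -[LHS](coefK w) poly_def.
rewrite (big_ord_widen _ (fun i => w`_i *: 'X^i) le_wl).
rewrite big_mkcond; apply: eq_bigr => j _; rewrite mul_polyC.
by case: ltnP => // /leq_sizeP/(_ _ (leqnn _)) ->; rewrite scale0r.
Qed.

(** The maximum with 1 accounts for z = 0, represented by the polynomial 0 of
    size 0 but of length 1. *)
Lemma is_lengthE p z (w : {poly int}) l : p.[0] != 0 ->
  digit_poly p w -> eqmodp p z%:P w ->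
  is_length p z l <-> l = maxn 1 (size w).
Proof.
move=> p0 dw ew.
have rep_max : canonical_rep p z (maxn 1 (size w)).
  by apply: digit_poly_canonical_rep dw ew; rewrite leq_max leqnn ?orbT.
have max_le k : canonical_rep p z k -> (maxn 1 (size w) <= k)%N.
  move=> rep_k; rewrite geq_max (proj1 rep_k) /=.
  have [w' [dw' ew' le_w'k]] := canonical_rep_digit_poly p0 rep_k.
  by rewrite (digit_poly_uniq dw dw' (eqmodp_trans (eqmodp_sym ew) ew')).
split=> [[rep_l min_l]|->]; last by split.
by apply/eqP; rewrite eqn_leq min_l // max_le.
Qed.

(** * Expansions in base -4 *)

Section BaseMinusFour.

Variables (m : nat) (P : {poly int}).
Hypotheses (hm : (0 < m)%N) (hP : P = 'X^(2 * m) + 2%:P * 'X^m + 2%:P).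

Lemma P_at0 : P.[0] = 2.
Proof. by rewrite hP !hornerE !expr0n; case: m hm => [|k] //= _; ring. Qed.

Lemma digitE u : digit P u = (u == 0) || (u == 1).
Proof. by rewrite /digit P_at0; lia. Qed.

(** The block of the base -4 digit b0 + 2 b1, with 2 written as
    X^(2m) + X^(3m). *)
Definition block (b0 b1 : bool) : {poly int} :=
  (b0%:R)%:P + (b1%:R)%:P * ('X^(2 * m) + 'X^(3 * m)).

Definition cons_block b0 b1 w := block b0 b1 + 'X^(4 * m) * w.

Lemma cons_block_eqmodp (b0 b1 : bool) z w : eqmodp P z%:P w ->
  eqmodp P (b0%:R + 2 * b1%:R - 4 * z)%:P (cons_block b0 b1 w).
Proof.
case=> q eq_q; rewrite /cons_block /block.
have -> : w = z%:P - q * P by rewrite -eq_q opprB addrC subrK.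
(* The cofactors come from Y^3 + Y^2 - 2 = P (Y - 1) and
   Y^4 + 4 = P (Y^2 - 2 Y + 2), with Y = X^m. *)
exists (- (b1%:R)%:P * ('X^m - 1) - z%:P * ('X^m ^+ 2 - 2%:P * 'X^m + 2%:P)
        + 'X^m ^+ 4 * q).
rewrite hP !(mulnC _ m) !exprM.
set Y := 'X^m; move: Y => Y.
ring.
Qed.

Lemma coef_block b0 b1 i :
  (block b0 b1)`_i =
  (b0 && (i == 0)%N)%:R + (b1 && ((i == 2 * m)%N || (i == 3 * m)%N))%:R.
Proof.
rewrite /block coefD coefC coefCM coefD !coefXn.
have : ~~ ((i == 2 * m)%N && (i == 3 * m)%N) by lia.
by case: (i == _) (i == _)%N (i == _)%N b0 b1 => [] [] [] [] [].
Qed.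

Lemma coef_block_ge b0 b1 i : (4 * m <= i)%N -> (block b0 b1)`_i = 0.
Proof.
move=> ge_i; rewrite coef_block.
have -> : (i == 0)%N = false by lia.
have -> : ((i == 2 * m)%N || (i == 3 * m)%N) = false by lia.
by rewrite !andbF.
Qed.

Lemma cons_block_digit_poly b0 b1 w :
  digit_poly P w -> digit_poly P (cons_block b0 b1 w).
Proof.
move=> dw i; rewrite /cons_block coefD mulrC coefMXn.
case: ltnP => [lt_i|ge_i].
  rewrite addr0 digitE coef_block.
  have : ~~ ((i == 0)%N && ((i == 2 * m)%N || (i == 3 * m)%N)) by lia.
  by case: (i == _)%N (_ || _) b0 b1 => [] [] [] [].
by rewrite coef_block_ge // add0r.
Qed.

Lemma size_cons_block b0 b1 w : w != 0 ->
  size (cons_block b0 b1 w) = (4 * m + size w)%N.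
Proof.
move=> w0; rewrite /cons_block addrC mulrC size_polyDl size_mulXn //.
have w_gt0 : (0 < size w)%N by rewrite size_poly_gt0.
suff: (size (block b0 b1) <= 4 * m)%N by lia.
by apply/leq_sizeP=> i; apply: coef_block_ge.
Qed.

Lemma size_block b0 b1 : size (block b0 b1) =
  if b1 then (3 * m).+1 else b0.
Proof.
case: b1; rewrite /block /=; last first.
  by rewrite mul0r addr0 size_polyC; case: b0.
rewrite mul1r addrA addrC size_polyDl size_polyXn //.
apply: leq_ltn_trans (size_polyD _ _) _; rewrite size_polyXn size_polyC.
by case: b0; rewrite gtn_max /=; lia.
Qed.

Definition length_at n l := l%:Z = m%:Z * (a n - 1) + 1.

Lemma a_SS n : a n.+2 = a n + 4.
Proof. by rewrite /= !exprS; ring. Qed.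

Lemma length_at_cons n l : length_at n l -> length_at n.+2 (4 * m + l).
Proof. by rewrite /length_at a_SS PoszD PoszM => ->; ring. Qed.

(** In the recursion z = (b0 + 2 b1) - 4 z' the quantity |3z - 1| decreases
    unless z = 0, although |z| does not for z = -1, where z' = 1. *)
Lemma digit_expansion z : exists w, [/\ digit_poly P w, eqmodp P z%:P w &
  w = 0 \/ exists2 n, (0 < n)%N & length_at n (size w)].
Proof.
have [k] := ubnP (absz (3 * z - 1)%R); elim: k z => // k IHk z le_zk.
have [->|z0] := eqVneq z 0.
  exists 0; split; last by left.
    by move=> i; rewrite coef0 digitE.
  by exists 0; rewrite polyC0 subrr mul0r.
have [b0 [b1 [z' def_z]]] : exists (b0 b1 : bool) z',
    z = b0%:R + 2 * b1%:R - 4 * z'.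
  have [q [c [c_lt4 def_z]]] : exists q c, (c < 4)%N /\ z = c%:Z - 4 * q.
    by exists (- (z %/ 4)%Z), (absz (z %% 4)%Z); lia.
  exists (odd c), (1 < c)%N, q; move: def_z.
  by case: c c_lt4 => [|[|[|[|]]]] //= _ ->; lia.
have [|w [dw ew lw]] := IHk z'; first by case: b0 b1 def_z => [] []; lia.
exists (cons_block b0 b1 w); split; rewrite ?def_z.
- exact: cons_block_digit_poly.
- exact: cons_block_eqmodp.
have [w0|w0] := eqVneq w 0; last first.
  case: lw => [/eqP|[n n_gt0 lw]]; first by rewrite (negbTE w0).
  by right; exists n.+2; rewrite ?size_cons_block //; apply: length_at_cons.
rewrite /cons_block w0 mulr0 addr0.
case: b1 {def_z}; [right; exists 2 | case: b0; [right; exists 1 | left]] => //.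
- by rewrite /length_at size_block /=; lia.
- by rewrite /length_at size_block /=; lia.
- by rewrite /block mul0r addr0 polyC0.
Qed.

Lemma length_attained n : (0 < n)%N -> exists z w,
  [/\ digit_poly P w, eqmodp P z%:P w, w != 0 & length_at n (size w)].
Proof.
have rep0 : digit_poly P 0 by move=> i; rewrite coef0 digitE.
have eq0 : eqmodp P 0%:P 0 by exists 0; rewrite polyC0 subrr mul0r.
have base b0 b1 : let w := cons_block b0 b1 0 in
    [/\ digit_poly P w, eqmodp P (b0%:R + 2 * b1%:R)%:P w
      & size w = if b1 then (3 * m).+1 else b0].
  split; first exact: cons_block_digit_poly.
    rewrite -[X in X%:P]subr0 -[X in _ - X](mulr0 4).
    exact: cons_block_eqmodp.
  by rewrite /cons_block mulr0 addr0 size_block.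
elim/ltn_ind: n => -[|[|[|n]]] // IHn _.
- have [dw ew sw] := base true false; do 2 eexists; split; eauto.
    by rewrite -size_poly_gt0 sw.
  by rewrite /length_at sw /=; lia.
- have [dw ew sw] := base false true; do 2 eexists; split; eauto.
    by rewrite -size_poly_gt0 sw.
  by rewrite /length_at sw /=; lia.
have [//|//|z [w [dw ew w0 lw]]] := IHn n.+1.
have sw := size_cons_block false false w0.
exists (- 4 * z), (cons_block false false w); split.
- exact: cons_block_digit_poly.
- by rewrite (_ : - 4 * z = false%:R + 2 * false%:R - 4 * z);
    [apply: cons_block_eqmodp | rewrite /=; ring].
- by rewrite -size_poly_gt0 sw addn_gt0 size_poly_gt0 w0 orbT.
by rewrite sw; apply: length_at_cons.
Qed.

End BaseMinusFour.

Theorem corollary2 (m : nat) (hm : (0 < m)%N) (P : {poly int})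
    (hP : P = 'X^(2 * m) + 2%:P * 'X^m + 2%:P) :
  (forall z : int, canonically_representable P z) /\
  (forall l : nat,
     (exists z : int, is_length P z l) <->
     (exists n : nat, (0 < n)%N /\ l%:Z = m%:Z * (a n - 1) + 1)).
Proof.
have p0 : P.[0] != 0 by rewrite (P_at0 hm hP).
split=> [z|l].
  have [w [dw ew _]] := digit_expansion hm hP z; exists (maxn 1 (size w)).
  by apply: digit_poly_canonical_rep dw ew; rewrite leq_max leqnn ?orbT.
split=> [[z]|[n [n_gt0 def_l]]].
  have [w [dw ew lw]] := digit_expansion hm hP z.
  rewrite (is_lengthE _ p0 dw ew) => ->.
  have [->|w0] := eqVneq w 0.
    (* z = 0 has length 1 = m (a 1 - 1) + 1. *)
    by exists 1; rewrite size_poly0 /=; lia.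
  case: lw => [/eqP|[n n_gt0 lw]]; first by rewrite (negbTE w0).
  by exists n; split=> //; rewrite (maxn_idPr _) ?size_poly_gt0.
have [z [w [dw ew w0 lw]]] := length_attained hm hP n_gt0.
exists z; rewrite (is_lengthE _ p0 dw ew) (maxn_idPr _) ?size_poly_gt0 //.
by move: lw; rewrite /length_at -def_l => -[->].
Qed.
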